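(* Let $C\ge 2$, let $(\mathbf{x}_i,y_i)$ be a forget sample with $y_i\in\{1,\dots,C\}$, and let $\mathbf{z}^g_i\in\mathbb{R}^C$ be the logits of the global model on $\mathbf{x}_i$, with $\mathbf{p}^g_i=\mathrm{softmax}(\mathbf{z}^g_i)$. Let $S_i=\sum_{c\neq y_i}e^{z^g_{i,c}}$ and, for $v\in\mathbb{R}$, define (non-true logits being fixed) $$p^{\mathrm{virt}}_{i,y_i}(v)=\frac{e^{v}}{e^{v}+S_i}.$$ For $v\in\mathbb{R}$ and small $\eta_u>0$, let $\Delta\ell_i(v):=\ell_i^{+}-\ell_i$ be the change in the per-sample cross-entropy produced by one knowledge-distillation step of size $\eta_u$ toward the virtual teacher with parameter $v$, with the student initialized at the global model. Then: 1. $p^{\mathrm{virt}}_{i,y_i}(v)$ is strictly increasing in $v$; 2. $\Delta\ell_i(v)$ strictly decreases as $v$ increases; 3. choosing $v=\min_{c}z^g_{i,c}$ (minimum over all $c\in\{1,\dots,C\}$) ensures $p^{\mathrm{virt}}_{i,y_i}\le 1/C$ and yields $$\Delta\ell_i\big(\min_{c} z^g_{i,c}\big)\ \ge\ \eta_u\,\frac{C}{C-1}\Big(p^g_{i,y_i}-\tfrac1C\Big)\big(1-p^g_{i,y_i}\big)+O(\eta_u^2)\qquad(\eta_u\to0^+).$$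
   Context: For $\mathbf{z}\in\mathbb{R}^C$, $\mathrm{softmax}(\mathbf{z})_c=e^{z_c}/\sum_{j=1}^C e^{z_j}$. For probability vectors with positive entries, $\mathrm{KL}(\mathbf{p}\|\mathbf{q})=\sum_{c} p_c\log(p_c/q_c)$. Virtual teacher with parameter $v$: logits $z^{\mathrm{virt}}_{i,y_i}=v$ and $z^{\mathrm{virt}}_{i,c}=z^g_{i,c}$ for $c\neq y_i$; probabilities $\mathbf{p}^{\mathrm{virt}}_i(v)=\mathrm{softmax}(\mathbf{z}^{\mathrm{virt}}_i)$, whose true-class entry is the $p^{\mathrm{virt}}_{i,y_i}(v)$ of the claim. Knowledge-distillation step of size $\eta_u$ on the student logits $\mathbf{z}^s_i$: $\mathbf{z}^{s+}_i=\mathbf{z}^s_i-\eta_u\nabla_{\mathbf{z}^s_i}\mathrm{KL}(\mathbf{p}^{\mathrm{virt}}_i(v)\|\mathbf{p}^s_i)$, where $\mathbf{p}^s_i=\mathrm{softmax}(\mathbf{z}^s_i)$ and the teacher is held fixed. Initialized at the global model means $\mathbf{z}^s_i=\mathbf{z}^g_i$. The cross-entropies before and after the step are $\ell_i=-\log p^s_{i,y_i}$ and $\ell_i^+=-\log \mathrm{softmax}(\mathbf{z}^{s+}_i)_{y_i}$. *)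

(* Defs.v *)
From HB Require Import structures.
From mathcomp Require Import all_boot all_order all_algebra.
From mathcomp Require Import all_classical all_reals all_analysis.

Set Implicit Arguments.
Unset Strict Implicit.
Unset Printing Implicit Defensive.

Import Order.TTheory GRing.Theory Num.Theory.
Import numFieldNormedType.Exports.

Local Open Scope ring_scope.
Local Open Scope classical_set_scope.

(* Logits and probability vectors over C classes are row vectors 'rV[R]_C,
   and classes are elements of 'I_C. *)

Definition softmax (R : realType) (C : nat) (z : 'rV[R]_C) : 'rV[R]_C :=
  \row_c (expR (z 0 c) / \sum_j expR (z 0 j)).

Definition KL (R : realType) (C : nat) (p q : 'rV[R]_C) : R :=
  \sum_c p 0 c * ln (p 0 c / q 0 c).

Definition cross_entropy (R : realType) (C : nat) (y : 'I_C) (z : 'rV[R]_C) : R :=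
  - ln (softmax z 0 y).

Definition gradient (R : realType) (C : nat) (f : 'rV[R]_C -> R)
    (z : 'rV[R]_C) : 'rV[R]_C :=
  \row_c 'D_(delta_mx 0 c) f z.

Definition virt_logits (R : realType) (C : nat) (zg : 'rV[R]_C) (y : 'I_C)
    (v : R) : 'rV[R]_C :=
  \row_c (if c == y then v else zg 0 c).

Definition virt_prob (R : realType) (C : nat) (zg : 'rV[R]_C) (y : 'I_C)
    (v : R) : 'rV[R]_C :=
  softmax (virt_logits zg y v).

Definition nontrue_mass (R : realType) (C : nat) (zg : 'rV[R]_C) (y : 'I_C) : R :=
  \sum_(c | c != y) expR (zg 0 c).

Definition virt_true_prob (R : realType) (C : nat) (zg : 'rV[R]_C) (y : 'I_C)
    (v : R) : R :=
  expR v / (expR v + nontrue_mass zg y).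

Lemma virt_true_probE (R : realType) (C : nat) (zg : 'rV[R]_C) (y : 'I_C) (v : R) :
  virt_prob zg y v 0 y = virt_true_prob zg y v.
Proof.
rewrite /virt_prob /softmax /virt_true_prob !mxE eqxx (bigD1 y)//= !mxE eqxx.
by congr (_ / (_ + _)); apply: eq_bigr => c /negbTE cy; rewrite !mxE cy.
Qed.

(* The teacher probabilities p do not depend on the variable of
   differentiation. *)
Definition kd_step (R : realType) (C : nat) (eta_u : R) (p : 'rV[R]_C)
    (zs : 'rV[R]_C) : 'rV[R]_C :=
  zs - eta_u *: gradient (fun z => KL p (softmax z)) zs.

(* The student is initialized at zg. *)
Definition delta_loss (R : realType) (C : nat) (zg : 'rV[R]_C) (y : 'I_C)
    (eta_u v : R) : R :=
  cross_entropy y (kd_step eta_u (virt_prob zg y v) zg) - cross_entropy y zg.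

(* Seeding the iterated minimum with the entry at y, itself one of the entries,
   gives the minimum over all classes, y included. *)
Definition min_logit (R : realType) (C : nat) (zg : 'rV[R]_C) (y : 'I_C) : R :=
  \big[Num.min/zg 0 y]_(c < C) zg 0 c.

(* Main.v *)
Require Import Defs.
From HB Require Import structures.
From mathcomp Require Import all_boot all_order all_algebra.
From mathcomp Require Import all_classical all_reals all_analysis.
From mathcomp Require Import ring lra.

Set Implicit Arguments.
Unset Strict Implicit.
Unset Printing Implicit Defensive.

Import Order.TTheory GRing.Theory Num.Theory.
Import numFieldNormedType.Exports.

Local Open Scope ring_scope.
Local Open Scope classical_set_scope.

(* The gradient of KL(p || softmax z) in z is softmax z - p, and p^virt has the
   same conditional distribution s off the class y as p^g.  With g and q the
   masses they give to y, the new loss minus the old one is therefore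
     ln (sum_c p^g_c exp (eta (g - q) a_c)),  a_y = 0, a_c = 1 + s_c otherwise,
   which is strictly decreasing in q.  Jensen's inequality bounds it below by
   eta (g - q) (1 - g) (1 + sum_c s_c^2); here g >= q >= 0 and q <= 1/C for the
   minimal v, while sum_c s_c^2 >= 1/(C-1) by Cauchy-Schwarz. *)

(** * Inequalities for finite sums *)

Lemma ltr_sum_exists (R : numDomainType) (I : finType) (F G : I -> R) :
  (forall i, F i <= G i) -> (exists i, F i < G i) -> \sum_i F i < \sum_i G i.
Proof.
move=> FG [i FGi]; rewrite (bigD1 i) //= [ltRHS](bigD1 i) //=.
by apply: ltr_leD => //; apply: ler_sum.
Qed.

Lemma sum_expR_gt0 (R : realType) (I : finType) (i : I) (f : I -> R) :
  0 < \sum_j expR (f j).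
Proof.
rewrite (bigD1 i) //= ltr_pwDl ?expR_gt0 //.
by apply: sumr_ge0 => j _; exact: expR_ge0.
Qed.

(** Sum against [p] the tangent line of the exponential at the mean [m]: the deviations [a i - m]
    average to zero. *)
Lemma ln_jensen (R : realType) (I : finType) (p a : I -> R) :
  (forall i, 0 <= p i) -> \sum_i p i = 1 ->
  \sum_i p i * a i <= ln (\sum_i p i * expR (a i)).
Proof.
move=> p0 p1; set m := \sum_i p i * a i.
have le : expR m <= \sum_i p i * expR (a i).
  have -> : expR m = \sum_i p i * (expR m * (1 + (a i - m))).
    transitivity (expR m * ((1 - m) * \sum_i p i + m)); first by rewrite p1; ring.
    rewrite /m mulr_sumr -big_split /= mulr_sumr; apply: eq_bigr => i _.
    by rewrite -/m; ring.
  apply: ler_sum => i _; apply: ler_wpM2l => //.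
  rewrite -[a i in leRHS](subrKC m) expRD ler_wpM2l ?expR_ge0 //.
  exact: expR_ge1Dx.
rewrite -[leLHS]expRK ler_ln // posrE ?expR_gt0 //.
exact: lt_le_trans (expR_gt0 _) le.
Qed.

(** * Softmax and the gradient of the divergence in the logits *)

Section Softmax.
Variables (R : realType) (C : nat).
Implicit Types (z p : 'rV[R]_C) (y c : 'I_C).

Lemma softmax_gt0 z c : 0 < softmax z 0 c.
Proof. by rewrite mxE divr_gt0 ?expR_gt0 // (sum_expR_gt0 c). Qed.

Lemma sum_softmax z y : \sum_c softmax z 0 c = 1.
Proof.
under eq_bigr do rewrite mxE.
by rewrite -mulr_suml divff // gt_eqF // (sum_expR_gt0 y).
Qed.

Lemma ln_softmax z c : ln (softmax z 0 c) = z 0 c - ln (\sum_j expR (z 0 j)).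
Proof. by rewrite mxE ln_div ?posrE ?expR_gt0 ?(sum_expR_gt0 c) // expRK. Qed.

(** Isolates the dependence on [z], a linear term plus log-sum-exp; the latter has coefficient 1
    because [p] has total mass 1. *)
Lemma KL_softmax p z : (forall c, 0 < p 0 c) -> \sum_c p 0 c = 1 ->
  KL p (softmax z) =
    \sum_c p 0 c * ln (p 0 c) - \sum_c p 0 c * z 0 c + ln (\sum_j expR (z 0 j)).
Proof.
move=> p0 p1; rewrite -[ln _ in RHS]mul1r -p1 mulr_suml -sumrB -big_split /=.
apply: eq_bigr => c _.
by rewrite ln_div ?posrE ?softmax_gt0 // ln_softmax; ring.
Qed.

Lemma gradient_KL_softmax p z : (forall c, 0 < p 0 c) -> \sum_c p 0 c = 1 ->
  gradient (fun z => KL p (softmax z)) z = softmax z - p.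
Proof.
move=> p0 p1; apply/rowP => c; rewrite !mxE.
set A := \sum_(j | j != c) expR (z 0 j).
have A0 : 0 <= A by apply: sumr_ge0 => j _; exact: expR_ge0.
set K := \sum_c p 0 c * ln (p 0 c) - \sum_c p 0 c * z 0 c.
(* The divergence along the line through [z] in direction [c]: only the exponential of class [c]
   varies, and [A] collects the others. *)
pose g (t : R) : R := K - p 0 c * t + ln (A + expR (z 0 c + t)).
have gE h : KL p (softmax (h *: delta_mx 0 c + z)) = g h.
  rewrite KL_softmax // /g /K; congr (_ + ln _).
    rewrite -addrA -opprD; congr (_ - _).
    under eq_bigr do rewrite mxE mulrDr.
    rewrite big_split /= (bigD1 c) //= !mxE !eqxx mulr1 big1 ?addr0 1?addrC //.
    by move=> j /negbTE jc; rewrite !mxE jc !mulr0.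
  rewrite (bigD1 c) //= addrC !mxE !eqxx mulr1 [h + _]addrC; congr (_ + _).
  by apply: eq_bigr => j /negbTE jc; rewrite !mxE jc mulr0 add0r.
have -> : 'D_(delta_mx 0 c) (fun z => KL p (softmax z)) z = 'D_1 g 0.
  apply: (congr1 (fun f : R -> R => lim (f @ 0^'))); apply/funext => h /=.
  by rewrite gE -[z in softmax z]add0r -(scale0r (delta_mx 0 c)) gE addr0 [h *: 1]mulr1.
have pos : 0 < A + expR (z 0 c + 0) by rewrite ltr_wpDl ?expR_gt0.
have -> : g = cst K - p 0 c *: id +
    (@ln R \o (cst A + (expR \o (cst (z 0 c) + id)))).
  by apply/funext.
have dln := is_derive1_ln pos.
have dexp : is_derive (0 : R) 1 (cst A + (expR \o (cst (z 0 c) + id))) (expR (z 0 c + 0)).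
  by apply: is_derive_eq; rewrite !add0r mulr1.
have dcomp :=
  @is_derive1_comp _ _ (cst A + (expR \o (cst (z 0 c) + id))) _ _ _ dln dexp.
rewrite derive_val (bigD1 c) //= -/A addr0 sub0r [_%:A]mulr1.
by rewrite addrC mulrC [A + _]addrC.
Qed.

End Softmax.

(** * Loss change under a step toward the virtual teacher *)

Section VirtualTeacher.
Variables (R : realType) (C : nat) (zg : 'rV[R]_C) (y : 'I_C).
Hypothesis hC : (2 <= C)%N.

Let S := nontrue_mass zg y.
Let s c := expR (zg 0 c) / S.
Let g := softmax zg 0 y.

Lemma exists_nontrue : exists c, c != y.
Proof.
have : (0 < #|predC1 y|)%N by rewrite cardC1 card_ord; case: C hC => [|[]].
by case/card_gt0P => c; exists c.
Qed.

Lemma nontrue_mass_gt0 : 0 < nontrue_mass zg y.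
Proof.
have [c cy] := exists_nontrue.
rewrite /nontrue_mass (bigD1 c) //= ltr_pwDl ?expR_gt0 //.
by apply: sumr_ge0 => j _; exact: expR_ge0.
Qed.

Let S0 : 0 < S := nontrue_mass_gt0.

Lemma softmax_trueE : g = virt_true_prob zg y (zg 0 y).
Proof. by rewrite /g mxE (bigD1 y). Qed.

Lemma softmax_nontrueE c : softmax zg 0 c = expR (zg 0 c) / (expR (zg 0 y) + S).
Proof. by rewrite mxE [X in _ / X](bigD1 y). Qed.

Lemma virt_prob_nontrueE v c : c != y ->
  virt_prob zg y v 0 c = expR (zg 0 c) / (expR v + S).
Proof.
move=> cy; rewrite !mxE (negbTE cy) (bigD1 y) //= mxE eqxx.
by congr (_ / (_ + _)); apply: eq_bigr => j /negbTE jy; rewrite mxE jy.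
Qed.

Lemma virt_true_prob_ltr v1 v2 : v1 < v2 ->
  virt_true_prob zg y v1 < virt_true_prob zg y v2.
Proof.
move=> lt_v; rewrite /virt_true_prob -/S.
rewrite ltr_pdivrMr ?addr_gt0 ?expR_gt0 // mulrAC.
rewrite ltr_pdivlMr ?addr_gt0 ?expR_gt0 // !mulrDr.
by rewrite [expR v2 * expR v1]mulrC ltrD2l ltr_pM2r // ltr_expR.
Qed.

(** Each of the C - 1 terms of [S] is at least the exponential of the minimal logit. *)
Lemma virt_true_prob_min : virt_true_prob zg y (min_logit zg y) <= 1 / C%:R.
Proof.
have C0 : 0 < C%:R :> R by rewrite ltr0n; case: C hC.
have ev0 := expR_gt0 (min_logit zg y).
have : (C%:R - 1) * expR (min_logit zg y) <= S.
  rewrite -[1]/(1%:R) -natrB ?(ltn_trans _ hC) // mulr_natl.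
  have -> : (C - 1)%N = #|predC1 y| by rewrite cardC1 card_ord subn1.
  rewrite -sumr_const; apply: ler_sum => c _.
  by rewrite ler_expR; exact: bigmin_le.
rewrite /virt_true_prob -/S ler_pdivrMr ?addr_gt0 //.
rewrite mulrAC ler_pdivlMr // mul1r.
by move=> ?; lra.
Qed.

Let a c := if c == y then 0 else 1 + s c.

Let a_ge0 c : 0 <= a c.
Proof.
by rewrite /a; case: ifP => // _; rewrite addr_ge0 ?divr_ge0 ?expR_ge0 ?ltW.
Qed.

Let a_gt0 c : c != y -> 0 < a c.
Proof.
by move=> /negbTE cy; rewrite /a cy addr_gt0 ?divr_gt0 ?expR_gt0.
Qed.

(* By the gradient formula, the step shifts the logit of class c by
   e * (a c - 1), where e := eta * (p^g_y - p^virt_y). *)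
Lemma delta_lossE eta v :
  delta_loss zg y eta v =
  ln (\sum_c softmax zg 0 c * expR (eta * (g - virt_true_prob zg y v) * a c)).
Proof.
set q := virt_true_prob zg y v; set e := eta * (g - q).
have Z0 (z : 'rV[R]_C) : 0 < \sum_j expR (z 0 j) := sum_expR_gt0 y (fun j => z 0 j).
have stepE c : kd_step eta (virt_prob zg y v) zg 0 c = zg 0 c - e * (1 - a c).
  rewrite /kd_step gradient_KL_softmax //; last 2 first.
  - by move=> j; exact: softmax_gt0.
  - exact: sum_softmax.
  rewrite mxE [X in _ + X]mxE [X in _ - X]mxE [X in eta * X]mxE.
  rewrite [X in eta * (_ + X)]mxE.
  rewrite -mulrA; congr (_ - _ * _); rewrite /a.
  have [->|cy] := eqVneq c y; first by rewrite virt_true_probE subr0 mulr1.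
  (* The two probabilities of [c] are [(1 - g) * s c] and [(1 - q) * s c], so they differ by
     [(q - g) * s c]. *)
  rewrite softmax_nontrueE virt_prob_nontrueE // /q softmax_trueE.
  rewrite /virt_true_prob -/S /s; field.
  by rewrite !gt_eqF ?addr_gt0 ?expR_gt0.
(* The factor [expR e] accounts for the true logit, which the step lowers by [e] since [a y = 0]. *)
have -> : \sum_c softmax zg 0 c * expR (e * a c) =
    expR e * (\sum_c expR (kd_step eta (virt_prob zg y v) zg 0 c)) /
    (\sum_c expR (zg 0 c)).
  rewrite mulr_sumr mulr_suml; apply: eq_bigr => c _.
  rewrite stepE mxE -expRD mulrAC -expRD; congr (expR _ / _); ring.
rewrite ln_div ?posrE ?mulr_gt0 ?expR_gt0 // lnM ?posrE ?expR_gt0 // expRK.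
by rewrite /delta_loss /cross_entropy !ln_softmax stepE /a eqxx; ring.
Qed.

Lemma delta_loss_ltr eta v1 v2 : 0 < eta -> v1 < v2 ->
  delta_loss zg y eta v2 < delta_loss zg y eta v1.
Proof.
move=> eta0 /virt_true_prob_ltr lt_q; rewrite !delta_lossE.
have ex0 v : 0 < \sum_c softmax zg 0 c * expR (eta * (g - virt_true_prob zg y v) * a c).
  rewrite (bigD1 y) //= ltr_pwDl ?mulr_gt0 ?softmax_gt0 ?expR_gt0 //.
  by apply: sumr_ge0 => c _; rewrite mulr_ge0 ?expR_ge0 // ltW ?softmax_gt0.
rewrite ltr_ln ?posrE //; apply: ltr_sum_exists => [c|].
  rewrite ler_pM2l ?softmax_gt0 // ler_expR ler_wpM2r //.
  by rewrite ler_pM2l // lerD2l lerN2 ltW.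
(* Strictness must come from a class other than [y], where [a] is positive. *)
have [c cy] := exists_nontrue; exists c.
rewrite ltr_pM2l ?softmax_gt0 // ltr_expR ltr_pM2r ?a_gt0 //.
by rewrite ltr_pM2l // ltrD2l ltrN2.
Qed.

(** Cauchy-Schwarz in variance form: the squared deviations of [s] from the uniform weight 1/(C - 1)
    have a nonnegative sum. *)
Lemma sum_nontrue_sqr : C%:R / (C%:R - 1) <= 1 + \sum_(c | c != y) s c ^+ 2.
Proof.
have n0 : 0 < C%:R - 1 :> R by rewrite subr_gt0 ltr1n.
have s1 : \sum_(c | c != y) s c = 1 by rewrite -mulr_suml divff // gt_eqF.
have cardE : \sum_(c < C | c != y) 1 = C%:R - 1 :> R.
  have -> : \sum_(c < C | c != y) 1 = \sum_(c in predC1 y) 1 :> R by [].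
  by rewrite sumr_const cardC1 card_ord -subn1 natrB ?(ltn_trans _ hC).
have : 0 <= \sum_(c | c != y) (s c - (C%:R - 1)^-1) ^+ 2.
  by apply: sumr_ge0 => c _; exact: sqr_ge0.
have -> : \sum_(c | c != y) (s c - (C%:R - 1)^-1) ^+ 2 =
    \sum_(c | c != y) s c ^+ 2 - (C%:R - 1)^-1.
  transitivity (\sum_(c | c != y) s c ^+ 2 - (C%:R - 1)^-1 *+ 2 * \sum_(c | c != y) s c
     + (C%:R - 1)^-1 ^+ 2 * \sum_(c < C | c != y) 1).
    rewrite !mulr_sumr -sumrB -big_split /=; apply: eq_bigr => c _; ring.
  by rewrite s1 cardE; field; rewrite gt_eqF.
have -> : C%:R / (C%:R - 1) = 1 + (C%:R - 1)^-1 :> R by field; rewrite gt_eqF.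
by rewrite subr_ge0 lerD2l.
Qed.

(* The loss is convex in eta, so it dominates its tangent at 0 and no
   remainder term is needed. *)
Lemma delta_loss_min_ge eta : 0 < eta ->
  eta * (C%:R / (C%:R - 1)) * (g - 1 / C%:R) * (1 - g)
    <= delta_loss zg y eta (min_logit zg y).
Proof.
move=> eta0; rewrite delta_lossE; set q := virt_true_prob _ _ _.
(* The minimum is at most its seed, the true logit. *)
have gq : 0 <= g - q.
  rewrite subr_ge0 softmax_trueE /q.
  have : min_logit zg y <= zg 0 y by exact: bigmin_le_id.
  by rewrite le_eqVlt => /predU1P[->//|/virt_true_prob_ltr/ltW].
apply: le_trans (ln_jensen _ _ (sum_softmax zg y)); last first.
  by move=> c; exact/ltW/softmax_gt0.
have g1 : 0 < 1 - g.
  rewrite softmax_trueE subr_gt0 ltr_pdivrMr ?addr_gt0 ?expR_gt0 //.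
  by rewrite mul1r ltrDl.
have -> : \sum_c softmax zg 0 c * (eta * (g - q) * a c) =
    eta * (g - q) * (1 - g) * (1 + \sum_(c | c != y) s c ^+ 2).
  rewrite (bigD1 y) //= {1}/a eqxx !mulr0 add0r.
  (* With 1 written as the sum of the [s c], both sides match termwise: off [y], softmax is
     [(1 - g) * s c] and [a c] is [1 + s c]. *)
  have {2}-> : 1 = \sum_(c | c != y) s c by rewrite -mulr_suml divff // gt_eqF.
  rewrite -big_split /= mulr_sumr; apply: eq_bigr => c /negbTE cy.
  rewrite softmax_nontrueE softmax_trueE /a cy /s /virt_true_prob -/S; field.
  by rewrite !gt_eqF ?addr_gt0 ?expR_gt0.
have -> : eta * (C%:R / (C%:R - 1)) * (g - 1 / C%:R) * (1 - g) =
  eta * (1 - g) * ((g - 1 / C%:R) * (C%:R / (C%:R - 1))) by ring.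
rewrite [X in _ <= X * _]mulrAC -[leRHS]mulrA ler_pM2l ?mulr_gt0 //.
(* The intermediate value is [(g - q) * (C / (C - 1))]: as [g - 1 / C] may be negative, the bound on
   the sum of squares is multiplied by [g - q] instead. *)
apply: le_trans (ler_wpM2l gq sum_nontrue_sqr).
rewrite ler_wpM2r ?divr_ge0 ?subr_ge0 ?ler0n ?ler1n ?(ltn_trans _ hC) //.
by rewrite lerD2l lerN2 virt_true_prob_min.
Qed.

End VirtualTeacher.

Theorem proposition1 (R : realType) (C : nat) (hC : (2 <= C)%N)
    (y : 'I_C) (zg : 'rV[R]_C) :
  [/\ (forall v1 v2 : R, v1 < v2 ->
         virt_true_prob zg y v1 < virt_true_prob zg y v2),
      (\forall eta_u \near 0^'+, forall v1 v2 : R, v1 < v2 ->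
         delta_loss zg y eta_u v2 < delta_loss zg y eta_u v1),
      virt_true_prob zg y (min_logit zg y) <= 1 / C%:R
    & exists r : R -> R,
        r =O_ (0^'+) (fun eta_u : R => eta_u ^+ 2) /\
        (\forall eta_u \near 0^'+,
           eta_u * (C%:R / (C%:R - 1)) * (softmax zg 0 y - 1 / C%:R)
             * (1 - softmax zg 0 y) + r eta_u
           <= delta_loss zg y eta_u (min_logit zg y))].
Proof.
split.
- by move=> v1 v2; exact: virt_true_prob_ltr.
- near=> eta; move=> v1 v2; apply: delta_loss_ltr => //.
- exact: virt_true_prob_min.
(* The lower bound holds exactly, so the zero function serves as remainder. *)
- exists (fun=> 0); split.
    apply/eqOP; near=> k; near=> eta.
    by rewrite normr0 mulr_ge0.
  near=> eta; rewrite addr0; exact: delta_loss_min_ge.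
Unshelve. all: by end_near.
Qed.
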